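(* Suppose $\Theta$ is a metric space and that $\theta\mapsto r(\theta,\delta)$ is continuous on $\Theta$ for every $\delta\in\mathcal D$. Let $\delta_0\in\mathcal D$ and $\mathcal C\subset\mathcal D$. If there exists $\epsilon\in{}^*\mathbb R$, $\epsilon>0$, such that ${}^*\delta_0$ is $\epsilon$-${}^*$Bayes among $\mathcal C^{*}=\{{}^*\delta:\delta\in\mathcal C\}$ with respect to an $\epsilon$-regular nonstandard prior $\pi$, then ${}^*\delta_0$ is ${}^*$admissible in $\Theta/{}^*\Theta$ among $\mathcal C^{*}$.
   Context: Statistical decision problem: a nonempty parameter space $\Theta$, here a metric space with metric $d$ and Borel $\sigma$-algebra $\mathcal B[\Theta]$; a measurable space $\mathbb A$ of actions; a loss $\ell:\Theta\times\mathbb A\to[0,\infty)$, measurable in the action; a measurable sample space $X$; probability measures $(P_\theta)_{\theta\in\Theta}$ on $X$. A (randomized) decision procedure is a map $\delta$ from $X$ to the probability measures on $\mathbb A$, with $\delta(x,A):=(\delta(x))(A)$, such that $x\mapsto\int_{\mathbb A}\ell(\theta,a)\,\delta(x,da)$ is measurable for every $\theta$. Its risk is $r(\theta,\delta)=\int_X\big[\int_{\mathbb A}\ell(\theta,a)\,\delta(x,da)\big]P_\theta(dx)$. $\mathcal D$ is the set of decision procedures with $r(\theta,\delta)<\infty$ for all $\theta$. Nonstandard setting: work in a nonstandard extension ${}^*$ of a superstructure over a ground set containing $\mathbb R\cup\Theta\cup\mathbb A\cup X$, with ${}^*s=s$ for elements $s$ of the ground set, satisfying transfer and as much saturation as necessary.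 The risk extends to ${}^*r:{}^*\Theta\times{}^*\mathcal D\to{}^*\mathbb R$. For $x,y\in{}^*\mathbb R$, $x\approx y$ means $|x-y|$ is infinitesimal, and $x\gg y$ means $\gamma x>y$ for every standard real $\gamma>0$. A nonstandard prior $\Pi$ is an internal probability measure on $({}^*\Theta,{}^*\mathcal B[\Theta])$. The internal Bayes risk is ${}^*r(\Pi,\Delta)=\int{}^*r(\theta,\Delta)\,\Pi(d\theta)$ (internal integral, with value in ${}^*[0,\infty]$). For $\epsilon\in{}^*[0,\infty)$ and $\mathcal E\subseteq{}^*\mathcal D$, $\Delta\in{}^*\mathcal D$ is $\epsilon$-${}^*$Bayes among $\mathcal E$ with respect to $\Pi$ if ${}^*r(\Pi,\Delta)\in{}^*\mathbb R$ and ${}^*r(\Pi,\Delta)\le{}^*r(\Pi,\Delta')+\epsilon$ for all $\Delta'\in\mathcal E$. A nonstandard prior $\pi$ is $\epsilon$-regular if $\pi(\{t\in{}^*\Theta:{}^*d(t,\theta_0)<\rho\})\gg\epsilon$ for every $\theta_0\in\Theta$ and every non-infinitesimal $\rho>0$. $\Delta\in{}^*\mathcal D$ is ${}^*$admissible in $\Theta/{}^*\Theta$ among $\mathcal E\subseteq{}^*\mathcal D$ if there is no $\Delta'\in\mathcal E$ such that ${}^*r(\theta,\Delta')\le{}^*r(\theta,\Delta)$ for all $\theta\in{}^*\Theta$ and ${}^*r(\theta_0,\Delta')\not\approx{}^*r(\theta_0,\Delta)$ for some $\theta_0\in\Theta$. *)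

(* Defs.v *)
From HB Require Import structures.
From mathcomp Require Import all_boot all_order all_algebra.
From mathcomp Require Import all_classical all_reals all_analysis.
From mathcomp Require Import measurable_realfun.

Set Implicit Arguments.
Unset Strict Implicit.
Unset Printing Implicit Defensive.

Import Order.TTheory GRing.Theory Num.Theory.
Import numFieldNormedType.Exports.

Local Open Scope classical_set_scope.
Local Open Scope ring_scope.
Local Open Scope card_scope.

(** [V_0(S) = S] and [V_(n+1)(S) = V_n(S) `|` P(V_n(S))], the members of the
    ground set [S] being urelements.  The superstructure [V(S)], the union of
    the [V_n(S)], is characterised up to a unique isomorphism over [S]. *)

Fixpoint rank_le (S U : Type) (mem : U -> U -> Prop) (atom : S -> U) (n : nat)
    : set U :=
  if n is m.+1 then
    rank_le mem atom m `|`
    [set a | ~ range atom a /\ [set x | mem x a] `<=` rank_le mem atom m]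
  else range atom.

(* [coll A] is the set whose members are the elements of [A]; it is
   unspecified when [A] has unbounded rank. *)
Record superstructure (S : Type) := Superstructure {
  elt :> Type;
  mem : elt -> elt -> Prop;
  atom : S -> elt;
  coll : set elt -> elt;
  atom_inj : injective atom;
  mem_atom : forall x s, ~ mem x (atom s);
  set_ext : forall a b, ~ range atom a -> ~ range atom b ->
    (forall x, mem x a <-> mem x b) -> a = b;
  rank_finite : forall a, exists n, rank_le mem atom n a;
  coll_set : forall n A, A `<=` rank_le mem atom n -> ~ range atom (coll A);
  mem_coll : forall n A, A `<=` rank_le mem atom n ->
    forall x, mem x (coll A) <-> A x
}.

Arguments mem {S V} _ _ : rename.
Arguments atom {S V} _ : rename.
Arguments coll {S V} _ : rename.

Definition ground (S : Type) (V : superstructure S) : V := coll (range atom).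

Definition is_set (S : Type) (V : superstructure S) (a : V) := ~ range atom a.

Definition opair (S : Type) (V : superstructure S) (a b : V) : V :=
  coll [set coll [set a]; coll [set a; b]].

(* The value at [x] of a function given as a set of ordered pairs; it is [x]
   itself when [x] is not in the domain. *)
Definition app (S : Type) (V : superstructure S) (f x : V) : V :=
  if pselect (exists y, mem (opair x y) f) is left h then projT1 (cid h)
  else x.

(** The language of a superstructure has a constant for each of its elements
    (the type [C] below), and its quantifiers are bounded. *)

Inductive term (C : Type) := Var of nat | Cst of C.

Inductive formula (C : Type) :=
| FEq of term C & term C
| FMem of term C & term C
| FNot of formula C
| FAnd of formula C & formula C
| FOr of formula C & formula C
| FImp of formula C & formula C
| FAll of nat & term C & formula C   (* [FAll i t p] is "for all x_i in t, p" *)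
| FEx of nat & term C & formula C.

Definition tfv (C : Type) (t : term C) : seq nat :=
  if t is Var i then [:: i] else [::].

Fixpoint ffv (C : Type) (p : formula C) : seq nat :=
  match p with
  | FEq t u | FMem t u => tfv t ++ tfv u
  | FNot p => ffv p
  | FAnd p q | FOr p q | FImp p q => ffv p ++ ffv q
  | FAll i t p | FEx i t p => tfv t ++ [seq j <- ffv p | j != i]
  end.

Definition sentence (C : Type) (p : formula C) := ffv p = [::].

Definition tmap (C D : Type) (f : C -> D) (t : term C) : term D :=
  match t with Var i => Var D i | Cst c => Cst (f c) end.

Fixpoint fmap (C D : Type) (f : C -> D) (p : formula C) : formula D :=
  match p with
  | FEq t u => FEq (tmap f t) (tmap f u)
  | FMem t u => FMem (tmap f t) (tmap f u)
  | FNot p => FNot (fmap f p)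
  | FAnd p q => FAnd (fmap f p) (fmap f q)
  | FOr p q => FOr (fmap f p) (fmap f q)
  | FImp p q => FImp (fmap f p) (fmap f q)
  | FAll i t p => FAll i (tmap f t) (fmap f p)
  | FEx i t p => FEx i (tmap f t) (fmap f p)
  end.

Section satisfaction.
Context {S : Type} {V : superstructure S}.

Definition teval (e : nat -> V) (t : term V) : V :=
  match t with Var i => e i | Cst c => c end.

Definition upd (e : nat -> V) (i : nat) (x : V) : nat -> V :=
  fun j => if j == i then x else e j.

Fixpoint sat (e : nat -> V) (p : formula V) : Prop :=
  match p with
  | FEq t u => teval e t = teval e u
  | FMem t u => mem (teval e t) (teval e u)
  | FNot p => ~ sat e p
  | FAnd p q => sat e p /\ sat e q
  | FOr p q => sat e p \/ sat e q
  | FImp p q => sat e p -> sat e q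
  | FAll i t p => forall x, mem x (teval e t) -> sat (upd e i x) p
  | FEx i t p => exists2 x, mem x (teval e t) & sat (upd e i x) p
  end.

Definition holds (p : formula V) := forall e, sat e p.

End satisfaction.

(** [V] and [W] are the superstructures over [S] and [*S], and [star] is the
    map [* : V(S) -> V( *S)].  The inclusion of [S] in [*S] is [incl], so that
    [star_atom] says [*s = s].  Saturation is for families of internal sets
    with fewer than [kappa] indices, [kappa] being the cardinal of [K]. *)
Record nonstandard_extension (S Sx : Type) (V : superstructure S)
    (W : superstructure Sx) (K : Type) := NonstandardExtension {
  star :> V -> W;
  incl : S -> Sx;
  incl_inj : injective incl;
  star_atom : forall s, star (atom s) = atom (incl s);
  star_ground : star (ground V) = ground W;
  transfer : forall p : formula V, sentence p ->
    (holds p <-> holds (fmap star p));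
  saturation : forall (I : set K) (A : K -> W),
    ~ ([set: K] #<= I) ->
    (forall i, I i -> is_set (A i) /\ exists a, mem (A i) (star a)) ->
    (forall J : set K, finite_set J -> J `<=` I ->
      exists x, forall i, J i -> mem x (A i)) ->
    exists x, forall i, I i -> mem x (A i)
}.

#[short(type="pointedMetricType")]
HB.structure Definition PointedMetric (K : numDomainType) :=
  {T of Pointed T & Metric K T}.

Notation borel T := (g_sigma_algebraType (@open T)).

Record decision_problem (R : realType) (Theta : Type) (dA dX : measure_display)
    (A : measurableType dA) (X : measurableType dX) := DecisionProblem {
  loss : Theta -> A -> R;
  loss_ge0 : forall t a, 0 <= loss t a;
  measurable_loss : forall t, measurable_fun [set: A] (loss t);
  model : Theta -> probability X R
}.

Section decision.
Context {R : realType} {Theta : pointedMetricType R} {dA dX : measure_display}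
  {A : measurableType dA} {X : measurableType dX}.
Variable M : decision_problem R Theta A X.
Local Open Scope ereal_scope.

Definition expected_loss (delta : X -> probability A R) (t : Theta) (x : X)
    : \bar R :=
  \int[delta x]_(a in [set: A]) (loss M t a)%:E.

Definition decision_procedure (delta : X -> probability A R) :=
  forall t, measurable_fun [set: X] (expected_loss delta t).

Definition risk (t : Theta) (delta : X -> probability A R) : \bar R :=
  \int[model M t]_(x in [set: X]) expected_loss delta t x.

Definition finite_risk_procedures : set (X -> probability A R) :=
  [set delta | decision_procedure delta /\ forall t, risk t delta < +oo].

Definition bayes_risk (pi : probability (borel Theta) R)
    (delta : X -> probability A R) : \bar R :=
  \int[pi]_(t in [set: borel Theta]) risk t delta.

End decision.

(** The ground set contains [R], [Theta], [A] and [X], possibly overlapping. *)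

Record ground_embedding (R Theta A X S : Type) := GroundEmbedding {
  real_in : R -> S;
  param_in : Theta -> S;
  action_in : A -> S;
  sample_in : X -> S;
  real_in_inj : injective real_in;
  param_in_inj : injective param_in;
  action_in_inj : injective action_in;
  sample_in_inj : injective sample_in
}.

Section coding.
Context {S : Type} {V : superstructure S}.

Definition cset (T : Type) (c : T -> V) (B : set T) : V := coll (c @` B).

Definition cpair (T U : Type) (c : T -> V) (c' : U -> V) (p : T * U) : V :=
  opair (c p.1) (c' p.2).

Definition cfun (T U : Type) (c : T -> V) (c' : U -> V) (D : set T)
    (f : T -> U) : V :=
  cset (fun t => opair (c t) (c' (f t))) D.

Context {R : realType} {Theta : pointedMetricType R} {dA dX : measure_display}
  {A : measurableType dA} {X : measurableType dX}.
Variable e : ground_embedding R Theta A X S.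

Definition creal (r : R) : V := atom (real_in e r).
Definition cparam (t : Theta) : V := atom (param_in e t).
Definition caction (a : A) : V := atom (action_in e a).
Definition csample (x : X) : V := atom (sample_in e x).

(* [+oo] and [-oo] are coded by two sets, hence by non-atoms. *)
Definition cereal (x : \bar R) : V :=
  match x with
  | r%:E => creal r
  | +oo%E => coll set0
  | -oo%E => coll [set coll set0]
  end.

(* A probability measure is its graph on the sigma-algebra. *)
Definition cprob (d : measure_display) (T : measurableType d) (c : T -> V)
    (P : probability T R) : V :=
  cfun (cset c) cereal measurable (fun B => P B).

Definition cprior (pi : probability (borel Theta) R) : V :=
  cprob (T := borel Theta) cparam pi.

Definition cproc (delta : X -> probability A R) : V :=
  cfun csample (cprob caction) setT delta.

Definition vR : V := cset creal setT.
Definition vTheta : V := cset cparam setT.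
Definition vpriors : V := cset cprior setT.

Definition vle : V := cset (cpair cereal cereal) [set p | (p.1 <= p.2)%E].
Definition vlt : V := cset (cpair cereal cereal) [set p | (p.1 < p.2)%E].
Definition vadd : V :=
  cfun (cpair cereal cereal) cereal setT (fun p => (p.1 + p.2)%E).
Definition vmul : V := cfun (cpair creal creal) creal setT (fun p => p.1 * p.2).
Definition vdistR : V :=
  cfun (cpair creal creal) creal setT (fun p => `|p.1 - p.2|).
Definition vdist : V :=
  cfun (cpair cparam cparam) creal setT (fun p => mdist p.1 p.2).

Variable M : decision_problem R Theta A X.

Definition vD : V := cset cproc (finite_risk_procedures M).

Definition vrisk : V :=
  cfun (cpair cparam cproc) creal [set p | finite_risk_procedures M p.2]
    (fun p => fine (risk M p.1 p.2)).

Definition vbayes : V :=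
  cfun (cpair cprior cproc) cereal [set p | finite_risk_procedures M p.2]
    (fun p => bayes_risk M p.1 p.2).

End coding.

(** Below, [*R], [*Theta], [*D] and the internal priors are sets in [W], that is
    in [V( *S)]; nonstandard numbers, parameters, procedures and priors are all
    elements of [W]. *)

Section nonstandard.
Context {S Sx : Type} {V : superstructure S} {W : superstructure Sx}
  {K : Type} {R : realType} {Theta : pointedMetricType R}
  {dA dX : measure_display} {A : measurableType dA} {X : measurableType dX}.
Variables (N : nonstandard_extension V W K)
  (e : ground_embedding R Theta A X S).

Definition hyperreal (x : W) := mem x (N (vR e)).
Definition star_real (r : R) : W := N (creal e r).
Definition star_le (x y : W) := mem (opair x y) (N (vle e)).
Definition star_lt (x y : W) := mem (opair x y) (N (vlt e)).
Definition star_add (x y : W) : W := app (N (vadd e)) (opair x y).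
Definition star_mul (x y : W) : W := app (N (vmul e)) (opair x y).
Definition star_distR (x y : W) : W := app (N (vdistR e)) (opair x y).

Definition infinitely_close (x y : W) :=
  forall gamma : R, 0 < gamma -> star_lt (star_distR x y) (star_real gamma).

Definition much_greater (x y : W) :=
  forall gamma : R, 0 < gamma -> star_lt y (star_mul (star_real gamma) x).

Definition star_param (t : W) := mem t (N (vTheta e)).
Definition star_dist (s t : W) : W := app (N (vdist e)) (opair s t).
Definition star_ball (t0 rho : W) : W :=
  coll [set t | star_param t /\ star_lt (star_dist t t0) rho].

Definition nonstandard_prior (Pi : W) := mem Pi (N (vpriors e)).

Definition regular_prior (eps Pi : W) :=
  forall (t0 : Theta) (rho : W), hyperreal rho -> star_lt (star_real 0) rho ->
    ~ infinitely_close rho (star_real 0) ->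
    much_greater (app Pi (star_ball (N (cparam e t0)) rho)) eps.

Variable M : decision_problem R Theta A X.

Definition star_procedure (Delta : W) := mem Delta (N (vD e M)).
Definition star_risk (t Delta : W) : W := app (N (vrisk e M)) (opair t Delta).
(* The internal integral of [star_risk _ Delta] against [Pi]: the extension to
   nonstandard priors and procedures of the standard Bayes risk. *)
Definition star_bayes_risk (Pi Delta : W) : W :=
  app (N (vbayes e M)) (opair Pi Delta).

Definition eps_star_bayes (eps Pi : W) (E : set W) (Delta : W) :=
  [/\ star_procedure Delta,
      hyperreal (star_bayes_risk Pi Delta) &
      forall Delta', E Delta' ->
        star_le (star_bayes_risk Pi Delta)
          (star_add (star_bayes_risk Pi Delta') eps)].

Definition star_admissible (E : set W) (Delta : W) :=
  star_procedure Delta /\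
  ~ exists Delta', [/\ E Delta',
      forall t, star_param t ->
        star_le (star_risk t Delta') (star_risk t Delta) &
      exists t0 : Theta,
        ~ infinitely_close (star_risk (N (cparam e t0)) Delta')
                           (star_risk (N (cparam e t0)) Delta)].

Definition star_proc (delta : X -> probability A R) : W := N (cproc e delta).

End nonstandard.

(* Main.v *)
(** Were some [delta] in [C] to dominate [delta0] with non-infinitesimal gain at
    a standard [t0], the standard risks would satisfy [r delta <= r delta0]
    everywhere, and by continuity [r delta + c <= r delta0] on a standard ball
    [B] around [t0], with [c > 0] standard.  Integrating gives
    [bayes P delta + c * P B <= bayes P delta0] for every standard prior [P].
    By transfer to [pi], the [eps]-Bayes property forces [c * pi ( *B) <= eps],
    against regularity. *)
Require Import Defs.
From mathcomp Require Import all_boot all_order all_algebra.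
From mathcomp Require Import all_classical all_reals all_analysis.
From mathcomp Require Import measurable_realfun.
Import numFieldNormedType.Exports.
Local Open Scope classical_set_scope.
Local Open Scope ring_scope.

(* [Defs] comes last so that [mem] is membership in a superstructure, not that
   of [ssrbool]. *)
Import Order.TTheory GRing.Theory Num.Theory Defs.

Set Implicit Arguments.
Unset Strict Implicit.
Unset Printing Implicit Defensive.

(** The weight lies on the word transfer. It applies only to bounded sentences built from equality
    and membership, so the integrated inequality has to be stated about codes of priors, procedures
    and balls, with functions replaced by their graphs. Each composite fact that crosses to [W]
    comes as a predicate on elements of a superstructure, a formula expressing it, and a
    satisfaction lemma valid in [V] and [W] alike. Two obstacles shape the rest. The ball of the
    regularity condition is collected outside the formal language; it is taken with a standard
    radius and identified with the star of a standard Borel set, at which transfer controls [pi].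
    And the Bayes risk of the competitor may a priori be infinite, so the transferred statement
    ranges over extended values; finiteness of the Bayes risk of [delta0] is what permits
    cancellation. *)

Section superstructures.
Context {S : Type} {V : superstructure S}.
Implicit Types (a b c d x y : V) (B : set V) (n : nat).

Local Notation rank n := (rank_le (@mem S V) (@atom S V) n).

(** [coll] is specified only on such sets, so every computation with a coded set carries a rank
    bound. *)
Definition bounded_rank B := exists n, B `<=` rank n.

Definition functional (f : V) :=
  forall x y z, mem (opair x y) f -> mem (opair x z) f -> y = z.

Lemma rank_le_mono m n : (m <= n)%N -> rank m `<=` rank n.
Proof.
elim: n => [|n IHn]; first by rewrite leqn0 => /eqP ->.
by rewrite leq_eqVlt => /orP[/eqP -> //|/IHn mn x /mn]; left.
Qed.

Lemma rank_le_mem n x a : mem x a -> rank n a -> rank n x.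
Proof.
elim: n => [|n IHn] /= xa.
  by move=> [s _ sa]; case: (mem_atom (s := s) (x := x)); rewrite sa.
by move=> [/(IHn xa)|[_ /(_ _ xa)]]; left.
Qed.

Lemma rank_le_coll n B : B `<=` rank n -> rank n.+1 (coll B).
Proof.
by move=> Bn; right; split=> [|x /(mem_coll Bn)/Bn//]; exact: coll_set Bn.
Qed.

Lemma in_coll B : bounded_rank B -> forall x, mem x (coll B) <-> B x.
Proof. by move=> [n Bn]; exact: mem_coll Bn. Qed.

Lemma is_set_coll B : bounded_rank B -> is_set (coll B).
Proof. by move=> [n Bn]; exact: coll_set Bn. Qed.

Lemma coll_inj B B' :
  bounded_rank B -> bounded_rank B' -> coll B = coll B' -> B = B'.
Proof.
move=> bB bB' BB'; apply/seteqP; split => x.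
  by move=> /(in_coll bB); rewrite BB' => /(in_coll bB').
by move=> /(in_coll bB'); rewrite -BB' => /(in_coll bB).
Qed.

Lemma is_set_mem x a : mem x a -> is_set a.
Proof. by move=> xa [s _ sa]; move: xa; rewrite -sa; exact: mem_atom. Qed.

Lemma coll_ext a B :
  is_set a -> bounded_rank B -> (forall x, mem x a <-> B x) -> a = coll B.
Proof.
move=> sa bB aB; apply: set_ext => //; first exact: is_set_coll.
by move=> x; rewrite aB; split=> /(in_coll bB).
Qed.

Lemma bounded_rank_mem a : bounded_rank [set x | mem x a].
Proof.
by have [n an] := rank_finite a; exists n => x /= xa; exact: rank_le_mem an.
Qed.

Lemma bounded_rank2 a b : bounded_rank [set a; b].
Proof.
have [[n an] [m bm]] := (rank_finite a, rank_finite b).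
exists (maxn n m) => x [|] ->; [apply: rank_le_mono an|apply: rank_le_mono bm].
  exact: leq_maxl.
exact: leq_maxr.
Qed.

Lemma in_coll2 a b x : mem x (coll [set a; b]) <-> (x = a \/ x = b).
Proof. exact/in_coll/bounded_rank2. Qed.

Lemma in_coll1 a x : mem x (coll [set a]) <-> x = a.
Proof. by rewrite -(setUid [set a]) in_coll2; split=> [[]|->] //; left. Qed.

Lemma in_opair a b x :
  mem x (opair a b) <-> (x = coll [set a] \/ x = coll [set a; b]).
Proof. exact: in_coll2. Qed.

Lemma rank_le_opair n a b : rank n a -> rank n b -> rank n.+2 (opair a b).
Proof.
by move=> an bn; apply: rank_le_coll => x [|] ->; apply: rank_le_coll => y;
  [move=> ->|move=> [|] ->].
Qed.

Lemma opair_inj a b c d : opair a b = opair c d -> a = c /\ b = d.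
Proof.
move=> abcd.
have ac : a = c.
  have : mem (coll [set c]) (opair a b) by rewrite abcd; apply/in_opair; left.
  move/in_opair => [E|E].
    by apply/in_coll1; rewrite E; apply/in_coll1.
  by apply/in_coll1; rewrite E; apply/in_coll2; left.
subst c; split => //.
have : mem (coll [set a; b]) (opair a d).
  by rewrite -abcd; apply/in_opair; right.
have : mem (coll [set a; d]) (opair a b).
  by rewrite abcd; apply/in_opair; right.
move=> /in_opair[] Ed /in_opair[] Eb.
- have -> : b = a by apply/in_coll1; rewrite -Eb; apply/in_coll2; right.
  by apply/esym/in_coll1; rewrite -Ed; apply/in_coll2; right.
- have da : d = a by apply/in_coll1; rewrite -Ed; apply/in_coll2; right.
  have /in_coll2 : mem b (coll [set a; d]).
    by rewrite -Eb; apply/in_coll2; right.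
  by rewrite da => -[].
- have ba : b = a by apply/in_coll1; rewrite -Eb; apply/in_coll2; right.
  have /in_coll2 : mem d (coll [set a; b]).
    by rewrite -Ed; apply/in_coll2; right.
  by rewrite ba => -[].
- have /in_coll2[ba|//] : mem b (coll [set a; d]).
    by rewrite -Eb; apply/in_coll2; right.
  have /in_coll2 : mem d (coll [set a; b]).
    by rewrite -Ed; apply/in_coll2; right.
  by rewrite ba => -[].
Qed.

Lemma app_mem f x y : mem (opair x y) f -> mem (opair x (app f x)) f.
Proof.
by move=> xyf; rewrite /app; case: pselect => [h|[]]; [case: cid|exists y].
Qed.

Lemma app_eq f x y : functional f -> mem (opair x y) f -> app f x = y.
Proof. by move=> ff xyf; apply: (ff x) => //; exact: app_mem xyf. Qed.

End superstructures.

(** * Bounded formulas for pairs, graphs and functions *)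

Section formulas.
Context {C : Type}.
Implicit Types (t u v f : term C) (n : nat).

Definition fresh n t := all (leq n) (tfv t).

(* The abbreviations below bind the variables [0] to [11]; the hypotheses
   [fresh n t] of their satisfaction lemmas rule out captures. *)
Definition pair_set_fml t u v :=
  FAnd (FMem u t) (FAnd (FMem v t)
    (FAll 0 t (FOr (FEq (Var C 0) u) (FEq (Var C 0) v)))).

(** The singleton in the Kuratowski pair is described as the set of [u] and [u], so [pair_set_fml]
    serves for both members. *)
Definition opair_fml t u v :=
  FAnd (FEx 1 t (pair_set_fml (Var C 1) u u))
  (FAnd (FEx 1 t (pair_set_fml (Var C 1) u v))
    (FAll 1 t (FOr (pair_set_fml (Var C 1) u u)
                   (pair_set_fml (Var C 1) u v)))).

Definition graph_fml t u f := FEx 2 f (opair_fml (Var C 2) t u).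

(** The quantifier over the inner pair needs a bound: that pair is the member of a singleton
    belonging to the outer pair, hence lies two levels below variable 2. *)
Definition graph2_fml t u v f :=
  FEx 2 f (FEx 3 (Var C 2) (FEx 4 (Var C 3)
    (FAnd (opair_fml (Var C 2) (Var C 4) v) (opair_fml (Var C 4) t u)))).

(* The values of a function [f] are bounded by the members of the members of
   its members, since [opair x y] is [{{x}, {x, y}}]. *)
Definition functional_fml f :=
  FAll 5 f (FAll 6 (Var C 5) (FAll 7 (Var C 6) (FAll 8 (Var C 6)
    (FAll 9 f (FAll 10 (Var C 9) (FAll 11 (Var C 10)
      (FImp (opair_fml (Var C 5) (Var C 7) (Var C 8))
        (FImp (opair_fml (Var C 9) (Var C 7) (Var C 11))
          (FEq (Var C 8) (Var C 11)))))))))).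

End formulas.

Section satisfaction_lemmas.
Context {S : Type} {V : superstructure S}.
Implicit Types (t u v f : term V) (e : nat -> V).

Lemma teval_upd e i x n t :
  fresh n t -> (i < n)%N -> teval (upd e i x) t = teval e t.
Proof.
case: t => //= j; rewrite /fresh /= andbT /upd => nj iltn.
by case: eqP => // ji; move: iltn; rewrite -ji ltnNge nj.
Qed.

Lemma teval_var e i x : teval (upd e i x) (Var V i) = x.
Proof. by rewrite /= /upd eqxx. Qed.

(** The conjunct [FMem u t] gives [t] a member, so [t] is not an atom and extensionality applies. *)
Lemma sat_pair_set e t u v : fresh 1 t -> fresh 1 u -> fresh 1 v ->
  sat e (pair_set_fml t u v) <->
  teval e t = coll [set teval e u; teval e v].
Proof.
move=> ft fu fv /=; split=> [[ut [vt tuv]]|->].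
  apply: coll_ext; [exact: is_set_mem ut|exact: bounded_rank2|move=> x].
  split=> [/tuv|[|] ->//].
  by rewrite /upd /= -!/(upd e 0 x) !(teval_upd _ _ (n := 1)).
split; first by apply/in_coll2; left.
split; first by apply/in_coll2; right.
by move=> x /in_coll2; rewrite !(teval_upd _ _ (n := 1)).
Qed.

Lemma fresh_le m n t : (m <= n)%N -> fresh n t -> fresh m t.
Proof. by move=> mn; apply: sub_all => j; exact: leq_trans. Qed.

Lemma sat_opair e t u v : fresh 2 t -> fresh 2 u -> fresh 2 v ->
  sat e (opair_fml t u v) <-> teval e t = opair (teval e u) (teval e v).
Proof.
move=> ft fu fv.
have s1 x w : fresh 2 w ->
    sat (upd e 1 x) (pair_set_fml (Var V 1) u w) <->
    x = coll [set teval e u; teval e w].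
  move=> fw; rewrite sat_pair_set// ?(@fresh_le 1 2)// ?teval_var.
  by rewrite !(teval_upd _ _ (n := 2))//; split.
rewrite /opair_fml /=; have [su sv] := (fun x => s1 x u fu, fun x => s1 x v fv).
split=> [[[x xt /su]]|tE].
  rewrite setUid => xE [[y yt /sv yE] tuv].
  apply: coll_ext; [exact: is_set_mem xt|exact: bounded_rank2|move=> z].
  rewrite xE in xt; rewrite yE in yt.
  split=> [/tuv[/su|/sv] ->|[|] ->//]; last by right.
  by rewrite setUid; left.
split; first exists (coll [set teval e u; teval e u]).
- by rewrite tE setUid; apply/in_opair; left.
- exact/su.
split; first exists (coll [set teval e u; teval e v]).
- by rewrite tE; apply/in_opair; right.
- exact/sv.
move=> x; rewrite tE => /in_opair[|] xE; [left; apply/su|right; exact/sv].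
by rewrite setUid.
Qed.

Lemma sat_graph e t u f : fresh 3 t -> fresh 3 u -> fresh 3 f ->
  sat e (graph_fml t u f) <->
  mem (opair (teval e t) (teval e u)) (teval e f).
Proof.
move=> ft fu ff; rewrite /graph_fml [sat _ _]/=.
have s x : sat (upd e 2 x) (opair_fml (Var V 2) t u) <->
    x = opair (teval e t) (teval e u).
  rewrite sat_opair// ?(@fresh_le 2 3)// ?teval_var.
  by rewrite !(teval_upd _ _ (n := 3))//; split.
split=> [[x xf /s <-]//|tuf].
by exists (opair (teval e t) (teval e u)) => //; apply/s.
Qed.

Lemma sat_graph2 e t u v f :
  fresh 5 t -> fresh 5 u -> fresh 5 v -> fresh 5 f ->
  sat e (graph2_fml t u v f) <->
  mem (opair (opair (teval e t) (teval e u)) (teval e v)) (teval e f).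
Proof.
move=> ft fu fv ff; rewrite /graph2_fml [sat _ _]/=.
have s x y z : let e' := upd (upd (upd e 2 x) 3 y) 4 z in
    sat e' (opair_fml (Var V 2) (Var V 4) v) /\
    sat e' (opair_fml (Var V 4) t u) <->
    x = opair z (teval e v) /\ z = opair (teval e t) (teval e u).
  move=> e1; rewrite !sat_opair// ?(@fresh_le 2 5)//.
  rewrite {}/e1 !(teval_upd _ _ ft)// !(teval_upd _ _ fu)//.
  by rewrite !(teval_upd _ _ fv)//; split.
split=> [[x xf [y _ [z _ /s[xE zE]]]]|tuvf]; first by rewrite -zE -xE.
set z := opair (teval e t) (teval e u).
exists (opair z (teval e v)) => //.
exists (coll [set z]); first by apply/in_opair; left.
by exists z; [exact/in_coll1|exact/(s _ (coll [set z]))].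
Qed.

Lemma sat_functional e f : fresh 12 f ->
  sat e (functional_fml f) <-> functional (teval e f).
Proof.
move=> ff; split=> [fml x y z xyf xzf|ffun].
  have p a b : mem (coll [set a; b]) (opair (V := V) a b).
    by apply/in_opair; right.
  have ml a b : mem a (coll (V := V) [set a; b]) by apply/in_coll2; left.
  have mr a b : mem b (coll (V := V) [set a; b]) by apply/in_coll2; right.
  rewrite /functional_fml in fml.
  move: fml => /(_ _ xyf _ (p x y) _ (ml x y) _ (mr x y) (opair x z)).
  rewrite !(teval_upd _ _ ff)// => /(_ xzf _ (p x z) _ (mr x z)) eqyz.
  by apply: eqyz; apply/sat_opair.
rewrite /functional_fml => p pf u _ x _ y _ q.
rewrite !(teval_upd _ _ ff)// => qf u' _ z _.
move=> /sat_opair E1 /sat_opair E2.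
by apply: (ffun x); [rewrite -E1|rewrite -E2].
Qed.

End satisfaction_lemmas.

(** * The statements to be transferred, with their formulas *)

Section connectives.
Context {S : Type} {V : superstructure S}.
Implicit Types (e : nat -> V) (i : nat) (p q : formula V).

(** The meanings of the parts are parameters, so satisfaction of a composite formula is assembled
    connective by connective and only the leaves evaluate the environment. *)
Lemma sat_all e i t p (P : V -> Prop) :
  (forall x, sat (upd e i x) p <-> P x) ->
  sat e (FAll i t p) <-> forall x, mem x (teval e t) -> P x.
Proof. by move=> pP; split=> h x xt; apply/pP; exact: h. Qed.

Lemma sat_ex e i t p (P : V -> Prop) :
  (forall x, sat (upd e i x) p <-> P x) ->
  sat e (FEx i t p) <-> exists2 x, mem x (teval e t) & P x.
Proof. by move=> pP; split=> -[x xt h]; exists x => //; apply/pP. Qed.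

Lemma sat_imp e p q (P Q : Prop) :
  (sat e p <-> P) -> (sat e q <-> Q) -> sat e (FImp p q) <-> (P -> Q).
Proof. by move=> pP qQ; split=> h /pP/h/qQ. Qed.

Lemma sat_and e p q (P Q : Prop) :
  (sat e p <-> P) -> (sat e q <-> Q) -> sat e (FAnd p q) <-> P /\ Q.
Proof. by move=> pP qQ; split=> -[/pP ? /qQ ?]. Qed.

Lemma sat_not e p (P : Prop) : (sat e p <-> P) -> sat e (FNot p) <-> ~ P.
Proof. by move=> pP; split=> h /pP/h. Qed.

(** Formulas have no function symbols, so a binary operation crosses as its graph; totality is what
    gives it values at nonstandard arguments. *)
Definition total2 (D1 D2 E f : V) :=
  forall x, mem x D1 -> forall y, mem y D2 ->
  exists2 z, mem z E & mem (opair (opair x y) z) f.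

Definition total2_fml (C : Type) (D1 D2 E f : C) :=
  FAll 5 (Cst D1) (FAll 6 (Cst D2) (FEx 7 (Cst E)
    (graph2_fml (Var C 5) (Var C 6) (Var C 7) (Cst f)))).

Lemma sat_total2 D1 D2 E f e :
  sat e (total2_fml D1 D2 E f) <-> total2 D1 D2 E f.
Proof.
apply: sat_all => x; apply: sat_all => y; apply: sat_ex => z.
exact: sat_graph2.
Qed.

(** Meant for the coded priors [F] and a Borel set [B]: after transfer each internal prior is
    single-valued and has a hyperreal mass at the starred set. *)
Definition family_at (F B E : V) :=
  forall Pi, mem Pi F -> functional Pi /\
    exists2 z, mem z E & mem (opair B z) Pi.

(** Variable 12 is the first one that [functional_fml] does not bind. *)
Definition family_at_fml (C : Type) (F B E : C) :=
  FAll 12 (Cst F) (FAnd (functional_fml (Var C 12))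
    (FEx 5 (Cst E) (graph_fml (Cst B) (Var C 5) (Var C 12)))).

Lemma sat_family_at F B E e :
  sat e (family_at_fml F B E) <-> family_at F B E.
Proof.
apply: sat_all => Pi; apply: sat_and; first exact: sat_functional.
by apply: sat_ex => z; exact: sat_graph.
Qed.

(** The distance is a bounded variable [d] tied to the graph [dist]; two implications stand for the
    biconditional that formulas lack. *)
Definition is_ball (T D t0 dist B r lt : V) :=
  forall x, mem x T -> forall d, mem d D ->
  mem (opair (opair x t0) d) dist ->
  (mem x B -> mem (opair d r) lt) /\ (mem (opair d r) lt -> mem x B).

Definition is_ball_fml (C : Type) (T D t0 dist B r lt : C) :=
  FAll 5 (Cst T) (FAll 6 (Cst D)
    (FImp (graph2_fml (Var C 5) (Cst t0) (Var C 6) (Cst dist))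
      (FAnd (FImp (FMem (Var C 5) (Cst B))
                  (graph_fml (Var C 6) (Cst r) (Cst lt)))
            (FImp (graph_fml (Var C 6) (Cst r) (Cst lt))
                  (FMem (Var C 5) (Cst B)))))).

Lemma sat_is_ball T D t0 dist B r lt e :
  sat e (is_ball_fml T D t0 dist B r lt) <-> is_ball T D t0 dist B r lt.
Proof.
apply: sat_all => t; apply: sat_all => d; apply: sat_imp.
  exact: sat_graph2.
by apply: sat_and; apply: sat_imp => //; exact: sat_graph.
Qed.

(* [b0 <= b1 + eps] and [m = Pi B] imply [c * m <= eps], where [b0] and [b1]
   are the Bayes risks of [d0] and [d1]. *)
Definition mass_le (P D E d0 d1 B c bayes add mul le lt : V) :=
  forall Pi, mem Pi P -> forall eps, mem eps D -> forall b0, mem b0 D ->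
  forall b1, mem b1 E -> forall s, mem s E -> forall m, mem m D ->
  forall g, mem g D ->
  mem (opair (opair Pi d0) b0) bayes -> mem (opair (opair Pi d1) b1) bayes ->
  mem (opair (opair b1 eps) s) add -> mem (opair b0 s) le ->
  mem (opair B m) Pi -> mem (opair (opair c m) g) mul ->
  ~ mem (opair eps g) lt.

Definition mass_le_fml (C : Type) (P D E d0 d1 B c bayes add mul le lt : C) :=
  FAll 5 (Cst P) (FAll 6 (Cst D) (FAll 7 (Cst D) (FAll 8 (Cst E)
  (FAll 9 (Cst E) (FAll 10 (Cst D) (FAll 11 (Cst D)
  (FImp (graph2_fml (Var C 5) (Cst d0) (Var C 7) (Cst bayes))
  (FImp (graph2_fml (Var C 5) (Cst d1) (Var C 8) (Cst bayes))
  (FImp (graph2_fml (Var C 8) (Var C 6) (Var C 9) (Cst add))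
  (FImp (graph_fml (Var C 7) (Var C 9) (Cst le))
  (FImp (graph_fml (Cst B) (Var C 10) (Var C 5))
  (FImp (graph2_fml (Cst c) (Var C 10) (Var C 11) (Cst mul))
  (FNot (graph_fml (Var C 6) (Var C 11) (Cst lt))))))))))))))).

Lemma sat_mass_le P D E d0 d1 B c bayes add mul le lt e :
  sat e (mass_le_fml P D E d0 d1 B c bayes add mul le lt) <->
  mass_le P D E d0 d1 B c bayes add mul le lt.
Proof.
do 7! [apply: sat_all => ?].
do 3! [apply: sat_imp; first exact: sat_graph2].
do 2! [apply: sat_imp; first exact: sat_graph].
by apply: sat_imp; [exact: sat_graph2|apply: sat_not; exact: sat_graph].
Qed.

End connectives.

(** * Consequences of transfer for the star map *)

Section star_map.
Context {S Sx : Type} {V : superstructure S} {W : superstructure Sx}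
  {K : Type} (N : nonstandard_extension V W K).
Implicit Types (a b c x y z f D E : V).

(** [P] and [Q] are the readings of one formula in [V] and in [W]. The equation for [q] holds by
    computation, as [fmap] only stars the constants. *)
Lemma star_transfer (p : formula V) (q : formula W) (P Q : Prop) :
  sentence p -> q = fmap N p ->
  (forall e, sat e p <-> P) -> (forall e, sat e q <-> Q) -> P -> Q.
Proof.
move=> sp -> pP qQ hP; apply/(qQ (fun=> ground W)).
by apply: (transfer N sp).1 => e; apply/pP.
Qed.

Lemma star_memP x a : mem (N x) (N a) <-> mem x a.
Proof.
have tr := @transfer _ _ _ _ _ N (FMem (Cst x) (Cst a)) erefl.
split=> xa; first exact: (tr.2 (fun=> xa) (fun=> x)).
exact: (tr.1 (fun=> xa) (fun=> N x)).
Qed.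

(** [is_set] is a condition on the range of [atom], outside the formal language; membership in the
    ground set is a form that [star_ground] carries over. *)
Lemma is_setE (U : Type) (Z : superstructure U) (a : Z) :
  is_set a <-> ~ mem a (ground Z).
Proof. by rewrite /ground in_coll//; exists 0%N. Qed.

Lemma star_is_set a : is_set a -> is_set (N a).
Proof. by rewrite !is_setE -(star_ground N) star_memP. Qed.

Lemma star_sub a b :
  (forall x, mem x a -> mem x b) -> forall x : W, mem x (N a) -> mem x (N b).
Proof.
apply: (@star_transfer (FAll 5 (Cst a) (FMem (Var V 5) (Cst b)))
                       (FAll 5 (Cst (N a)) (FMem (Var W 5) (Cst (N b))))) => //;
  by move=> e; apply: sat_all.
Qed.

Lemma star_opair a b : N (opair a b) = opair (N a) (N b).
Proof.
apply: (@star_transfer (opair_fml (Cst (opair a b)) (Cst a) (Cst b))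
  (opair_fml (Cst (N (opair a b))) (Cst (N a)) (Cst (N b)))
  (opair a b = opair a b)) => //; by move=> e; exact: sat_opair.
Qed.

Lemma star_functional f : functional f -> functional (N f).
Proof.
apply: (@star_transfer (functional_fml (Cst f)) (functional_fml (Cst (N f))))
  => // e; exact: sat_functional.
Qed.

Lemma star_total2 D1 D2 E f :
  total2 D1 D2 E f -> total2 (N D1) (N D2) (N E) (N f).
Proof.
apply: (@star_transfer (total2_fml D1 D2 E f)
  (total2_fml (N D1) (N D2) (N E) (N f))) => // e; exact: sat_total2.
Qed.

Lemma star_family_at F B E : family_at F B E -> family_at (N F) (N B) (N E).
Proof.
apply: (@star_transfer (family_at_fml F B E)
  (family_at_fml (N F) (N B) (N E))) => // e; exact: sat_family_at.
Qed.

Lemma star_is_ball T D t0 dist B r lt : is_ball T D t0 dist B r lt ->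
  is_ball (N T) (N D) (N t0) (N dist) (N B) (N r) (N lt).
Proof.
apply: (@star_transfer (is_ball_fml T D t0 dist B r lt)
  (is_ball_fml (N T) (N D) (N t0) (N dist) (N B) (N r) (N lt))) => // e;
  exact: sat_is_ball.
Qed.

Lemma star_mass_le P D E d0 d1 B c bayes add mul le lt :
  mass_le P D E d0 d1 B c bayes add mul le lt ->
  mass_le (N P) (N D) (N E) (N d0) (N d1) (N B) (N c) (N bayes) (N add)
    (N mul) (N le) (N lt).
Proof.
apply: (@star_transfer (mass_le_fml P D E d0 d1 B c bayes add mul le lt)
  (mass_le_fml (N P) (N D) (N E) (N d0) (N d1) (N B) (N c) (N bayes) (N add)
    (N mul) (N le) (N lt))) => // e; exact: sat_mass_le.
Qed.

Lemma star_app f x y :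
  functional f -> mem (opair x y) f -> app (N f) (N x) = N y.
Proof.
move=> ff xyf; apply: app_eq; first exact: star_functional.
by rewrite -star_opair star_memP.
Qed.

(** Totality provides a value in [N E], and single-valuedness identifies it with the one chosen by
    [app]. This turns applications such as [star_dist] or [star_mul] into the graph memberships of
    the transferred statements. *)
Lemma star_app2 D1 D2 E f : total2 D1 D2 E f -> functional f ->
  forall x y : W, mem x (N D1) -> mem y (N D2) ->
  mem (app (N f) (opair x y)) (N E) /\
  mem (opair (opair x y) (app (N f) (opair x y))) (N f).
Proof.
move=> /star_total2 ftotal ff x y /ftotal/[apply] -[z zE xyzf].
by rewrite (app_eq (star_functional ff) xyzf).
Qed.

End star_map.

(** * Codes of sets, pairs and functions *)

Section coding_lemmas.
Context {S : Type} {V : superstructure S}.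

Definition bounded_coding (T : Type) (c : T -> V) := bounded_rank (range c).

Lemma bounded_image (T : Type) (c : T -> V) (B : set T) :
  bounded_coding c -> bounded_rank (c @` B).
Proof. by move=> [n cn]; exists n => _ [t _ <-]; apply: cn; exists t. Qed.

Lemma in_cset (T : Type) (c : T -> V) (B : set T) x :
  bounded_coding c -> mem x (cset c B) <-> (c @` B) x.
Proof. by move=> bc; exact: in_coll (bounded_image B bc) x. Qed.

Lemma bounded_cset (T : Type) (c : T -> V) :
  bounded_coding c -> bounded_coding (cset c).
Proof.
move=> [n cn]; exists n.+1 => _ [B _ <-].
by apply: rank_le_coll => _ [t _ <-]; exact: cn.
Qed.

Lemma bounded_atom (T : Type) (f : T -> S) :
  bounded_coding (fun t => atom (f t) : V).
Proof. by exists 0%N => _ [t _ <-]; exists (f t). Qed.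

Lemma bounded_opair (T T1 T2 : Type) (c1 : T1 -> V) (c2 : T2 -> V)
    (f1 : T -> T1) (f2 : T -> T2) :
  bounded_coding c1 -> bounded_coding c2 ->
  bounded_coding (fun t => opair (c1 (f1 t)) (c2 (f2 t))).
Proof.
move=> [n cn] [m cm]; exists (maxn n m).+2 => _ [t _ <-].
apply: rank_le_opair.
  by apply: (rank_le_mono (leq_maxl n m)); apply: cn; exists (f1 t).
by apply: (rank_le_mono (leq_maxr n m)); apply: cm; exists (f2 t).
Qed.

Lemma bounded_cpair (T U : Type) (c : T -> V) (c' : U -> V) :
  bounded_coding c -> bounded_coding c' -> bounded_coding (cpair c c').
Proof. exact: bounded_opair. Qed.

Lemma bounded_cfun (T U : Type) (c : T -> V) (c' : U -> V) (D : set T) :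
  bounded_coding c -> bounded_coding c' -> bounded_coding (cfun c c' D).
Proof.
move=> bc bc'; have [n ccn] := bounded_opair fst snd bc bc'.
exists n.+1 => _ [f _ <-]; apply: rank_le_coll => _ [t _ <-].
by apply: ccn; exists (t, f t).
Qed.

Lemma in_cfun (T U : Type) (c : T -> V) (c' : U -> V) (D : set T) (f : T -> U)
    x y :
  bounded_coding c -> bounded_coding c' ->
  mem (opair x y) (cfun c c' D f) <-> exists2 t, D t & x = c t /\ y = c' (f t).
Proof.
move=> bc bc'; rewrite in_cset; last exact: (bounded_opair id f).
split=> [[t Dt /opair_inj[<- <-]]|[t Dt [-> ->]]]; last by exists t.
by exists t.
Qed.

Lemma functional_cfun (T U : Type) (c : T -> V) (c' : U -> V) (D : set T)
    (f : T -> U) :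
  bounded_coding c -> bounded_coding c' ->
  (forall s t, D s -> D t -> c s = c t -> f s = f t) ->
  functional (cfun c c' D f).
Proof.
move=> bc bc' fP x y z /in_cfun[]// s Ds [xs ->] /in_cfun[]// t Dt [xt ->].
by rewrite (fP s t)// -xs.
Qed.

Lemma cset_inj (T : Type) (c : T -> V) :
  bounded_coding c -> injective c -> injective (cset c).
Proof.
move=> bc cinj; have sub B B' : cset c B = cset c B' -> B `<=` B'.
  move=> BB' t Bt.
  have : mem (c t) (cset c B') by rewrite -BB'; apply/in_cset => //; exists t.
  by move=> /in_cset[]// s Bs /cinj <-.
by move=> B B' BB'; apply/seteqP; split; apply: sub.
Qed.

Lemma cpair_inj (T U : Type) (c : T -> V) (c' : U -> V) :
  injective c -> injective c' -> injective (cpair c c').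
Proof. by move=> ci ci' [t u] [t' u'] /opair_inj[/ci /= -> /ci' /= ->]. Qed.

(** The conclusion stays at the level of codes because [c'] may fail to be injective: the code of a
    measure ignores its values outside the sigma-algebra. *)
Lemma cfun_inj (T U : Type) (c : T -> V) (c' : U -> V) (D : set T)
    (f g : T -> U) :
  bounded_coding c -> bounded_coding c' -> injective c ->
  cfun c c' D f = cfun c c' D g -> forall t, D t -> c' (f t) = c' (g t).
Proof.
move=> bc bc' ci fg t Dt.
have : mem (opair (c t) (c' (f t))) (cfun c c' D g).
  by rewrite -fg; apply/in_cfun => //; exists t.
by move=> /in_cfun[]// s _ [/ci <-].
Qed.

Lemma cpair_graph (T U X : Type) (c : T -> V) (c' : U -> V) (c'' : X -> V)
    (D : set (T * U)) (f : T * U -> X) x y z :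
  bounded_coding c -> bounded_coding c' -> bounded_coding c'' ->
  mem (opair (opair x y) z) (cfun (cpair c c') c'' D f) <->
  exists t u, [/\ D (t, u), x = c t, y = c' u & z = c'' (f (t, u))].
Proof.
move=> bc bc' bc''; rewrite in_cfun//; last exact: bounded_cpair.
split=> [[[t u] Dtu [/opair_inj[-> ->] ->]]|[t [u [Dtu -> -> ->]]]].
  by exists t, u.
by exists (t, u).
Qed.

Lemma cpair_rel (T U : Type) (c : T -> V) (c' : U -> V) (D : set (T * U)) x y :
  bounded_coding c -> bounded_coding c' ->
  mem (opair x y) (cset (cpair c c') D) <->
  exists t u, [/\ D (t, u), x = c t & y = c' u].
Proof.
move=> bc bc'; rewrite in_cset; last exact: bounded_cpair.
split=> [[[t u] Dtu /opair_inj[<- <-]]|[t [u [Dtu -> ->]]]].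
  by exists t, u.
by exists (t, u).
Qed.

End coding_lemmas.

(** * The standard inequality between Bayes risks *)

Section risks.
Context {R : realType} {Theta : pointedMetricType R} {dA dX : measure_display}
  {A : measurableType dA} {X : measurableType dX}.
Variable M : decision_problem R Theta A X.
Implicit Types (delta : X -> probability A R) (P : probability (borel Theta) R).
Local Open Scope ereal_scope.

(** It suffices to test the open intervals generating the Borel sets of [R]; their preimages are
    open, hence generators of [borel Theta]. *)
Lemma continuous_borel_measurable (f : Theta -> R) :
  continuous f -> measurable_fun [set: borel Theta] (f : borel Theta -> R).
Proof.
move=> /continuousP cf; apply: (measurability _ (RGenOpens.measurableE R)).
move=> _ [_ [x [y ->]] <-]; rewrite setTI.
by apply: sub_sigma_algebra; apply: cf; exact: interval_open.
Qed.

Lemma risk_ge0 t delta : 0 <= risk M t delta.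
Proof.
apply: integral_ge0 => x _; apply: integral_ge0 => a _.
by rewrite lee_fin loss_ge0.
Qed.

Lemma fine_riskK t delta :
  finite_risk_procedures M delta -> (fine (risk M t delta))%:E = risk M t delta.
Proof. by move=> [_ fin]; rewrite fineK// ge0_fin_numE ?fin// risk_ge0. Qed.

Lemma bayes_risk_ge0 P delta : 0 <= bayes_risk M P delta.
Proof. by apply: integral_ge0 => t _; exact: risk_ge0. Qed.

(** Procedures with the same code agree only on measurable sets; this invariance makes the coded
    risk single-valued. *)
Lemma eq_risk t delta delta' :
  (forall x B, measurable B -> delta x B = delta' x B) ->
  risk M t delta = risk M t delta'.
Proof.
move=> dd'; apply: eq_integral => x _.
by apply: eq_measure_integral => B mB _; exact: dd'.
Qed.

Lemma eq_bayes_risk P P' delta delta' :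
  (forall B, measurable B -> P B = P' B) ->
  (forall x B, measurable B -> delta x B = delta' x B) ->
  bayes_risk M P delta = bayes_risk M P' delta'.
Proof.
move=> PP' dd'; transitivity (bayes_risk M P' delta); last first.
  by apply: eq_integral => t _; exact: eq_risk.
by apply: eq_measure_integral => B mB _; exact: PP'.
Qed.

(** With [c * P B] written as the integral of [c] times the indicator of [B], the integrands compare
    pointwise: by the gap on [B], by domination off [B]. Nonnegativity makes the integral additive
    even at infinite values, and continuity gives measurability. *)
Lemma le_bayes_riskD P delta delta' (B : set Theta) (c : R) :
  finite_risk_procedures M delta -> finite_risk_procedures M delta' ->
  continuous (fun t : Theta => fine (risk M t delta)) ->
  continuous (fun t : Theta => fine (risk M t delta')) ->
  open B -> (0 <= c)%R ->
  (forall t, (fine (risk M t delta') <= fine (risk M t delta))%R) ->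
  (forall t, B t -> (fine (risk M t delta') + c <= fine (risk M t delta))%R) ->
  bayes_risk M P delta' + c%:E * P B <= bayes_risk M P delta.
Proof.
move=> fd fd' cd cd' oB c0 le_dd' le_B.
have mB : measurable (B : set (borel Theta)) by exact: sub_sigma_algebra.
have mrisk del : finite_risk_procedures M del ->
    continuous (fun t : Theta => fine (risk M t del)) ->
    measurable_fun [set: borel Theta] (risk M ^~ del : borel Theta -> \bar R).
  move=> fdel /continuous_borel_measurable mdel.
  rewrite (_ : risk M ^~ del = EFin \o (fun t => fine (risk M t del))).
    exact/measurable_EFinP.
  by apply/funext => t /=; rewrite fine_riskK.
have mind : measurable_fun [set: borel Theta] (fun t => (\1_B t)%:E : \bar R).
  exact/measurable_EFinP/measurable_indic.
rewrite -[B in P B](setIT B) -(integral_indic _ measurableT)//.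
rewrite -ge0_integralZl_EFin//.
rewrite /bayes_risk -ge0_integralD//; last 4 first.
- by move=> t _; exact: risk_ge0.
- exact: mrisk.
- by move=> t _; rewrite mule_ge0.
- exact: measurable_funeM.
apply: ge0_le_integral => //.
- by move=> t _; rewrite adde_ge0 ?risk_ge0 ?mule_ge0.
- apply: emeasurable_funD; [exact: mrisk|exact: measurable_funeM].
- exact: mrisk.
move=> t _; rewrite -(fine_riskK t fd) -(fine_riskK t fd') -EFinM -EFinD.
rewrite lee_fin indicE.
case: (boolP (t \in B)) => [|_]; last by rewrite mulr0 addr0.
by rewrite inE mulr1 => /le_B.
Qed.

End risks.

(** * Codes of the decision problem and the inequality on codes *)

Section decision_codings.
Context {S : Type} {V : superstructure S} {R : realType}
  {Theta : pointedMetricType R} {dA dX : measure_display}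
  {A : measurableType dA} {X : measurableType dX}.
Variables (e : ground_embedding R Theta A X S)
  (M : decision_problem R Theta A X).
Implicit Types (delta : X -> probability A R) (P : probability (borel Theta) R).

Local Notation creal := (creal (V := V) e).
Local Notation cparam := (cparam (V := V) e).
Local Notation cereal := (cereal (V := V) e).
Local Notation cproc := (cproc (V := V) e).
Local Notation cprior := (cprior (V := V) e).
Local Notation vpriors := (vpriors (V := V) e).
Local Notation vR := (vR (V := V) e).
Local Notation vE := (cset cereal setT).
Local Notation vTheta := (vTheta (V := V) e).

Lemma bounded_creal : bounded_coding creal.
Proof. exact: bounded_atom. Qed.

Lemma bounded_cparam : bounded_coding cparam.
Proof. exact: bounded_atom. Qed.

Lemma bounded_cereal : bounded_coding cereal.
Proof.
(* Reals are atoms of rank 0, the empty set coding [+oo] has rank 1, and its singleton coding [-oo]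
   has rank 2. *)
exists 2%N => _ [[r| |] _ <-].
- by apply: (@rank_le_mono _ _ 0) => //; exists (real_in e r).
- exact/(@rank_le_mono _ _ 1)/rank_le_coll.
- by apply: rank_le_coll => _ ->; exact: rank_le_coll.
Qed.

Lemma bounded_cprob d (T : measurableType d) (c : T -> V) :
  bounded_coding c -> bounded_coding (cprob (R := R) e c).
Proof.
move=> bc.
have [n cn] := bounded_cfun measurable (bounded_cset bc) bounded_cereal.
by exists n => _ [P _ <-]; apply: cn; exists (fun B => P B).
Qed.

Lemma bounded_cprior : bounded_coding cprior.
Proof. exact/bounded_cprob/bounded_cparam. Qed.

Lemma bounded_cproc : bounded_coding cproc.
Proof.
have [n cn] := bounded_cfun setT (bounded_atom (V := V) (sample_in e))
  (bounded_cprob (bounded_atom (V := V) (action_in e))).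
by exists n => _ [delta _ <-]; apply: cn; exists delta.
Qed.

Lemma creal_inj : injective creal.
Proof. by move=> r s E; exact: real_in_inj (atom_inj E). Qed.

Lemma cparam_inj : injective cparam.
Proof. by move=> r s E; exact: param_in_inj (atom_inj E). Qed.

(** Reals are atoms and the infinities are sets, told apart by the member that only the code of
    [-oo] has. *)
Lemma cereal_inj : injective cereal.
Proof.
have b0 : bounded_rank (V := V) set0 by exists 0%N.
have s0 := is_set_coll b0.
have b1 : bounded_rank [set coll (V := V) set0].
  by rewrite -(setUid [set _]); exact: bounded_rank2.
have s1 := is_set_coll b1.
have ne : coll (V := V) set0 <> coll [set coll set0].
  by move=> /(coll_inj b0 b1)/seteqP[_ /(_ (coll set0))]; apply.
have at0 r : creal r <> coll set0 by move=> E; apply: s0; exists (real_in e r).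
have at1 r : creal r <> coll [set coll set0].
  by move=> E; apply: s1; exists (real_in e r).
move=> [r| |] [s| |] //=; first by move=> /creal_inj ->.
- by move=> /at0.
- by move=> /at1.
- by move=> /esym/at0.
- by move=> /esym/at1.
- by move=> /esym.
Qed.

Lemma cprob_eq d (T : measurableType d) (c : T -> V) (P P' : probability T R) :
  bounded_coding c -> injective c -> cprob e c P = cprob e c P' ->
  forall B, measurable B -> P B = P' B.
Proof.
move=> bc ci PP' B mB; apply: cereal_inj.
exact: (cfun_inj (bounded_cset bc) bounded_cereal (cset_inj bc ci) PP').
Qed.

Lemma cproc_eq delta delta' : cproc delta = cproc delta' ->
  forall x B, measurable B -> delta x B = delta' x B.
Proof.
have ba := bounded_atom (V := V) (action_in e).
have bx := bounded_atom (V := V) (sample_in e).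
have xi : injective (csample (V := V) e).
  by move=> y z E; exact: sample_in_inj (atom_inj E).
move=> dd' x; apply: (cprob_eq ba).
  by move=> a b E; exact: action_in_inj (atom_inj E).
exact: (cfun_inj bx (bounded_cprob ba) xi dd').
Qed.

Lemma cprior_eq P P' : cprior P = cprior P' ->
  forall B, measurable B -> P B = P' B.
Proof.
exact: (@cprob_eq _ (borel Theta) cparam _ _ bounded_cparam cparam_inj).
Qed.

Lemma functional_vrisk : functional (vrisk (V := V) e M).
Proof.
apply: functional_cfun.
- exact: bounded_cpair bounded_cparam bounded_cproc.
- exact: bounded_creal.
move=> [t d] [t' d'] _ _ /opair_inj[/= /cparam_inj -> /cproc_eq dd'].
by rewrite (eq_risk _ _ dd').
Qed.

Lemma functional_vbayes : functional (vbayes (V := V) e M).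
Proof.
apply: functional_cfun.
- exact: bounded_cpair bounded_cprior bounded_cproc.
- exact: bounded_cereal.
move=> [P d] [P' d'] _ _ /opair_inj[/= /cprior_eq PP' /cproc_eq dd'].
exact: eq_bayes_risk.
Qed.

Lemma functional_vadd : functional (vadd (V := V) e).
Proof.
apply: functional_cfun.
- exact: bounded_cpair bounded_cereal bounded_cereal.
- exact: bounded_cereal.
by move=> p q _ _ /(cpair_inj cereal_inj cereal_inj) ->.
Qed.

Lemma functional_vmul : functional (vmul (V := V) e).
Proof.
apply: functional_cfun.
- exact: bounded_cpair bounded_creal bounded_creal.
- exact: bounded_creal.
by move=> p q _ _ /(cpair_inj creal_inj creal_inj) ->.
Qed.

Lemma functional_vdistR : functional (vdistR (V := V) e).
Proof.
apply: functional_cfun.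
- exact: bounded_cpair bounded_creal bounded_creal.
- exact: bounded_creal.
by move=> p q _ _ /(cpair_inj creal_inj creal_inj) ->.
Qed.

Lemma functional_vdist : functional (vdist (V := V) e).
Proof.
apply: functional_cfun.
- exact: bounded_cpair bounded_cparam bounded_cparam.
- exact: bounded_creal.
by move=> p q _ _ /(cpair_inj cparam_inj cparam_inj) ->.
Qed.

Lemma total2_cfun (T U Z : Type) (c : T -> V) (c' : U -> V) (c'' : Z -> V)
    (B : set U) (f : T * U -> Z) :
  bounded_coding c -> bounded_coding c' -> bounded_coding c'' ->
  total2 (cset c setT) (cset c' B) (cset c'' setT)
    (cfun (cpair c c') c'' [set p | B p.2] f).
Proof.
move=> bc bc' bc'' x /in_cset[]// t _ <- y /in_cset[]// u Bu <-.
exists (c'' (f (t, u))); first by apply/in_cset => //; exists (f (t, u)).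
by apply/cpair_graph => //; exists t, u.
Qed.

Lemma total2_cfunT (T U Z : Type) (c : T -> V) (c' : U -> V) (c'' : Z -> V)
    (f : T * U -> Z) :
  bounded_coding c -> bounded_coding c' -> bounded_coding c'' ->
  total2 (cset c setT) (cset c' setT) (cset c'' setT)
    (cfun (cpair c c') c'' setT f).
Proof. exact: total2_cfun. Qed.

Lemma vle_fin (r s : R) :
  mem (opair (creal r) (creal s)) (vle e) <-> r <= s.
Proof.
rewrite cpair_rel; [|exact: bounded_cereal..].
split=> [[x [y [/= xy Ex Ey]]]|rs].
  move: xy; rewrite -(@cereal_inj r%:E _ Ex) -(@cereal_inj s%:E _ Ey).
  by rewrite lee_fin.
by exists r%:E, s%:E; rewrite /= lee_fin.
Qed.

Lemma vlt_fin (r s : R) :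
  mem (opair (creal r) (creal s)) (vlt e) <-> r < s.
Proof.
rewrite cpair_rel; [|exact: bounded_cereal..].
split=> [[x [y [/= xy Ex Ey]]]|rs].
  move: xy; rewrite -(@cereal_inj r%:E _ Ex) -(@cereal_inj s%:E _ Ey).
  by rewrite lte_fin.
by exists r%:E, s%:E; rewrite /= lte_fin.
Qed.

Lemma vpriors_family_at (B : set (borel Theta)) : measurable B ->
  family_at vpriors (cset cparam B) vR.
Proof.
have bc := bounded_cset bounded_cparam; have be := bounded_cereal.
move=> mB _ /in_cset[|P _ <-]; first exact: bounded_cprior.
split.
  apply: functional_cfun => // C D _ _.
  by move=> /(cset_inj bounded_cparam cparam_inj) ->.
exists (creal (fine (P B))).
  by apply/in_cset; [exact: bounded_creal|exists (fine (P B))].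
apply/in_cfun => //; exists B => //; split => //.
(* A probability is finite, so this value is the code of a real: [cereal r%:E] is [creal r]. *)
by rewrite -[X in cereal X]fineK// fin_num_measure.
Qed.

Lemma vTheta_is_ball (t0 : Theta) (r : R) :
  is_ball vTheta vR (cparam t0) (vdist e)
    (cset cparam [set t | mdist t t0 < r]) (creal r) (vlt e).
Proof.
have [bt br] := (bounded_cparam, bounded_creal).
move=> _ /in_cset[]// t _ <- _ /in_cset[]// d _ <-.
move=> /cpair_graph[]// s [u [_ /cparam_inj <- /cparam_inj <- /creal_inj ->]].
split=> [/in_cset[]// v /= vr /cparam_inj <-|/vlt_fin rr]; first exact/vlt_fin.
by apply/in_cset => //; exists t.
Qed.

(** With [b] the Bayes risk of [delta'], [le_bayes_riskD] and the premise on [le] give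
    [b + c * m <= b0 <= b + eps], and cancelling [b] leaves [c * m <= eps]. *)
Lemma vpriors_mass_le delta delta' (B : set Theta) (c : R) :
  finite_risk_procedures M delta -> finite_risk_procedures M delta' ->
  continuous (fun t : Theta => fine (risk M t delta)) ->
  continuous (fun t : Theta => fine (risk M t delta')) ->
  open B -> 0 <= c ->
  (forall t, fine (risk M t delta') <= fine (risk M t delta)) ->
  (forall t, B t -> fine (risk M t delta') + c <= fine (risk M t delta)) ->
  mass_le vpriors vR vE (cproc delta) (cproc delta') (cset cparam B) (creal c)
    (vbayes e M) (vadd e) (vmul e) (vle e) (vlt e).
Proof.
move=> fd fd' cd cd' oB c0 le_dd' le_B.
have [bP bd] := (bounded_cprior, bounded_cproc).
have [br be] := (bounded_creal, bounded_cereal).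
have bB := bounded_cset bounded_cparam.
move=> _ /in_cset[]// P _ <- _ /in_cset[]// eps _ <- _ /in_cset[]// b0 _ <-.
move=> _ /in_cset[]// b1 _ <- _ /in_cset[]// s _ <- _ /in_cset[]// m _ <-.
move=> _ /in_cset[]// g _ <-.
(* Decoding returns a prior and a procedure that merely share the given codes; [eq_bayes_risk]
   restores the original ones. *)
move=> /cpair_graph[]// P0 [d0 [_ /cprior_eq P0E /cproc_eq d0E]].
move=> /(@cereal_inj b0%:E) /=; rewrite -(eq_bayes_risk M P0E d0E) => b0E.
move=> /cpair_graph[]// P1 [d1 [_ /cprior_eq P1E /cproc_eq d1E]].
move=> /cereal_inj /=; rewrite -(eq_bayes_risk M P1E d1E) => b1E.
move=> /cpair_graph[]// x [y [_ /cereal_inj <- /(@cereal_inj eps%:E) <-]].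
move=> /cereal_inj /= sE.
move=> /cpair_rel[]// x' [y' [/= + /(@cereal_inj b0%:E) Ex /cereal_inj Ey]].
rewrite -{}Ex -{}Ey {}sE {}b1E => le_eps.
move=> /in_cfun[]// B' _ [/(cset_inj bounded_cparam cparam_inj) <-].
move=> /(@cereal_inj m%:E) mE.
move=> /cpair_graph[]// x'' [y'' [_ /creal_inj <- /creal_inj <- /creal_inj ->]].
move=> /vlt_fin /=; apply/negP; rewrite -leNgt.
have := le_bayes_riskD P fd fd' cd cd' oB c0 le_dd' le_B.
rewrite -mE; move: le_eps (bayes_risk_ge0 M P delta'); rewrite -b0E.
(* The value [+oo] contradicts the upper bound by the real [b0], and [-oo] contradicts
   nonnegativity. *)
case: (bayes_risk M P delta') => [b| |]//=.
rewrite -EFinM -!EFinD !lee_fin => b0_le _ le_b0.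
by rewrite -(lerD2l b); exact: le_trans b0_le.
Qed.

End decision_codings.

Lemma open_mdist_ball (R : realType) (T : pointedMetricType R) (x : T) (r : R) :
  open [set y | mdist y x < r].
Proof.
rewrite openE => y /= yxr; rewrite /interior -nbhs_ballE.
exists (r - mdist y x) => [|z]; first by rewrite /= subr_gt0.
rewrite ballEmdist /= ltrBrDr metric_sym; exact/le_lt_trans/metric_triangle.
Qed.

(** * Nonstandard notions at standard arguments *)

Section standard_values.
Context {S Sx : Type} {V : superstructure S} {W : superstructure Sx}
  {K : Type} {R : realType} {Theta : pointedMetricType R}
  {dA dX : measure_display} {A : measurableType dA} {X : measurableType dX}.
Variables (N : nonstandard_extension V W K)
  (e : ground_embedding R Theta A X S) (M : decision_problem R Theta A X).
Implicit Types (delta : X -> probability A R).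

Lemma star_real_hyperreal (r : R) : hyperreal N e (star_real N e r).
Proof. by apply/star_memP/in_cset; [exact: bounded_creal|exists r]. Qed.

Lemma star_le_real (r s : R) :
  star_le N e (star_real N e r) (star_real N e s) <-> r <= s.
Proof. by rewrite /star_le -star_opair star_memP vle_fin. Qed.

Lemma star_lt_real (r s : R) :
  star_lt N e (star_real N e r) (star_real N e s) <-> r < s.
Proof. by rewrite /star_lt -star_opair star_memP vlt_fin. Qed.

Lemma star_distR_real (r s : R) :
  star_distR N e (star_real N e r) (star_real N e s) = star_real N e `|r - s|.
Proof.
rewrite /star_distR -star_opair.
apply: star_app; first exact: functional_vdistR.
apply/cpair_graph; [exact: bounded_creal..|].
by exists r, s.
Qed.

(** For distinct standard reals the distance is itself an admissible [gamma], and would have to be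
    smaller than itself. *)
Lemma infinitely_close_real (r s : R) :
  infinitely_close N e (star_real N e r) (star_real N e s) <-> r = s.
Proof.
split=> [rs|-> gamma gamma0]; last first.
  by rewrite star_distR_real subrr normr0; apply/star_lt_real.
apply/eqP; rewrite -subr_eq0 -normr_eq0; apply: contraT => rs0.
have /rs : 0 < `|r - s| by rewrite lt_neqAle eq_sym rs0 normr_ge0.
by rewrite star_distR_real => /star_lt_real; rewrite ltxx.
Qed.

Lemma star_risk_standard (t : Theta) delta : finite_risk_procedures M delta ->
  star_risk N e M (N (cparam e t)) (star_proc N e delta) =
  star_real N e (fine (risk M t delta)).
Proof.
move=> fd; rewrite /star_risk -star_opair.
apply: star_app; first exact: functional_vrisk.
apply/cpair_graph; [exact: bounded_cparam|exact: bounded_cproc|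
  exact: bounded_creal|].
by exists t, delta.
Qed.

(** [star_ball] is formed by [coll] in [W]; being the star of a standard Borel set makes its mass
    accessible to [family_at] and [mass_le]. *)
Lemma star_ballE (t0 : Theta) (r : R) :
  star_ball N e (N (cparam e t0)) (star_real N e r) =
  N (cset (cparam e) [set t | mdist t t0 < r]).
Proof.
set B := [set t | _]; have bt := bounded_cparam (V := V) e.
(* Transferred separately, since [is_ball] constrains only those members of [B] that are
   parameters. *)
have BT : forall x, mem x (N (cset (cparam e) B)) -> star_param N e x.
  apply: star_sub => x /in_cset[]// t _ <-; by apply/in_cset => //; exists t.
have t0T : mem (N (cparam e t0)) (N (vTheta e)).
  by apply/star_memP/in_cset => //; exists t0.
have inB x : star_param N e x /\
    star_lt N e (star_dist N e x (N (cparam e t0))) (star_real N e r) <->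
    mem x (N (cset (cparam e) B)).
  have ball : is_ball (N (vTheta e)) (N (vR e)) (N (cparam e t0))
      (N (vdist e)) (N (cset (cparam e) B)) (N (creal e r)) (N (vlt e)).
    exact/star_is_ball/vTheta_is_ball.
  have tot : total2 (vTheta e) (vTheta e) (vR e) (vdist (V := V) e).
    by apply: total2_cfunT => //; exact: bounded_creal.
  split=> [[xT]|xB].
    have [dR xd] := star_app2 tot (@functional_vdist _ _ _ _ _ _ _ _ e) xT t0T.
    exact: (ball _ xT _ dR xd).2.
  have xT := BT x xB; split=> //.
  have [dR xd] := star_app2 tot (@functional_vdist _ _ _ _ _ _ _ _ e) xT t0T.
  exact: (ball _ xT _ dR xd).1.
apply/esym/coll_ext; first exact/star_is_set/is_set_coll/bounded_image.
  have [n Bn] := bounded_rank_mem (N (cset (cparam e) B)).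
  by exists n => x /inB/Bn.
by move=> x; exact: iff_sym (inB x).
Qed.

End standard_values.

Theorem theorem7p4 (R : realType) (Theta : pointedMetricType R)
    (dA dX : measure_display) (A : measurableType dA) (X : measurableType dX)
    (M : decision_problem R Theta A X)
    (S Sx : Type) (e : ground_embedding R Theta A X S)
    (V : superstructure S) (W : superstructure Sx)
    (K : Type) (uncountable_K : ~ countable [set: K])
    (N : nonstandard_extension V W K)
    (risk_continuous : forall delta, finite_risk_procedures M delta ->
      continuous (fun t : Theta => fine (risk M t delta)))
    (delta0 : X -> probability A R)
    (Ddelta0 : finite_risk_procedures M delta0)
    (C : set (X -> probability A R))
    (CD : C `<=` finite_risk_procedures M) :
  (exists eps pi : W,
    [/\ hyperreal N e eps,
        star_lt N e (star_real N e 0) eps,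
        nonstandard_prior N e pi,
        regular_prior N e eps pi &
        eps_star_bayes N e M eps pi (star_proc N e @` C)
          (star_proc N e delta0)]) ->
  star_admissible N e M (star_proc N e @` C) (star_proc N e delta0).
Proof.
move=> [eps [pi [epsR _ piP reg [Ddelta0' b0R bayes]]]]; split => //.
move=> [_ [[delta Cdelta <-] dom [t0 far]]]; have Ddelta := CD _ Cdelta.
pose f t := fine (risk M t delta0) - fine (risk M t delta).
have le_risk t : fine (risk M t delta) <= fine (risk M t delta0).
  have := dom (N (cparam e t)).
  rewrite !star_risk_standard// star_le_real; apply.
  by apply/star_memP/in_cset; [exact: bounded_cparam|exists t].
have f0 : 0 < f t0.
  rewrite subr_gt0 lt_neqAle le_risk andbT; apply/eqP => eq_risk0; apply: far.
  by rewrite !star_risk_standard//; apply/infinitely_close_real.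
have [rho rho0 f_ball] : exists2 rho : R, 0 < rho &
    forall t, mdist t t0 < rho -> f t0 / 2 < f t.
  have cf : f t @[t --> t0] --> f t0.
    by apply: cvgB; exact: risk_continuous.
  (* Half the gap at [t0] is still positive, yet strictly below [f t0], so [f] exceeds it near
     [t0]. *)
  have /cf : nbhs (f t0) [set x | f t0 / 2 < x].
    by apply: lt_nbhsr; rewrite ltr_pdivrMr// ltr_pMr// ltr1n.
  rewrite -nbhs_ballE => -[rho /= rho0 sub]; exists rho => // t trho.
  by apply: sub; rewrite ballEmdist /= metric_sym.
pose B : set Theta := [set t | mdist t t0 < rho].
have oB : open B by exact: open_mdist_ball.
have c0 : 0 < f t0 / 2 by rewrite divr_gt0.
have mass : mass_le (N (vpriors e)) (N (vR e)) (N (cset (cereal e) setT))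
    (star_proc N e delta0) (star_proc N e delta) (N (cset (cparam e) B))
    (star_real N e (f t0 / 2)) (N (vbayes e M)) (N (vadd e)) (N (vmul e))
    (N (vle e)) (N (vlt e)).
  apply/star_mass_le/vpriors_mass_le => //;
    [exact: risk_continuous|exact: risk_continuous|exact: ltW|].
  by move=> t /f_ball /ltW; rewrite lerBrDl addrC.
have [br be] := (bounded_creal (V := V) e, bounded_cereal (V := V) e).
have [bP bd] := (bounded_cprior (V := V) e, bounded_cproc (V := V) e).
have vD del : finite_risk_procedures M del ->
    mem (star_proc N e del) (N (vD e M)).
  by move=> fdel; apply/star_memP/in_cset => //; exists del.
(* Addition is coded on extended reals, so [eps] must be placed among them. *)
have epsE : mem eps (N (cset (cereal e) setT)).
  move: epsR; apply: star_sub => x /in_cset[]// r _ <-.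
  by apply/in_cset => //; exists r%:E.
have fam : family_at (N (vpriors e)) (N (cset (cparam e) B)) (N (vR e)).
  apply/star_family_at/vpriors_family_at.
  exact: sub_sigma_algebra.
have [pi_fun [m mR Bm]] := fam _ piP.
have rho_far : ~ infinitely_close N e (star_real N e rho) (star_real N e 0).
  by move/infinitely_close_real => rho_eq0; move: rho0; rewrite rho_eq0 ltxx.
(* Regularity at the standard radius [rho], with factor [f t0 / 2], yields exactly the strict
   inequality that [mass] denies. *)
have := reg t0 _ (star_real_hyperreal N e rho)
  (iffRL (star_lt_real N e 0 rho) rho0) rho_far _ c0.
rewrite star_ballE (app_eq pi_fun Bm).
have [gR cmg] := star_app2 (total2_cfunT _ br br br) (functional_vmul (e := e))
  (star_real_hyperreal N e (f t0 / 2)) mR.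
have bayes_val del : finite_risk_procedures M del ->
    mem (star_bayes_risk N e M pi (star_proc N e del))
      (N (cset (cereal e) setT)) /\
    mem (opair (opair pi (star_proc N e del))
      (star_bayes_risk N e M pi (star_proc N e del))) (N (vbayes e M)).
  move=> /vD delD; apply: (star_app2 _ _ piP delD).
    exact: total2_cfun.
  exact: functional_vbayes.
have [_ b0_val] := bayes_val _ Ddelta0.
(* In contrast to [b0R], the Bayes risk of [delta] is placed only among extended values, as the
   variable [b1] of [mass_le] allows. *)
have [b1E b1_val] := bayes_val _ Ddelta.
have [sE s_val] := star_app2 (total2_cfunT _ be be be)
  (functional_vadd (e := e)) b1E epsE.
apply: (mass _ piP _ epsR _ b0R _ b1E _ sE _ mR _ gR) => //.
by apply: bayes; exists delta.
Qed.
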